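(* The frame property $(c)$ is undefinable in $\mathcal{L}(W)$, and the frame property $(r)$ is undefinable in $\mathcal{L}(W)$.
   Context: Fix a nonempty set $\mathbf{P}$ of propositional variables, $p\in\mathbf{P}$. $\mathcal{L}(W)$: $\varphi::=p\mid\neg\varphi\mid\varphi\land\varphi\mid W\varphi$. A neighborhood frame is $\mathcal{F}=\langle S,N\rangle$ with $S$ a nonempty set and $N:S\to\mathcal{P}(\mathcal{P}(S))$; a model $\mathcal{M}=\langle S,N,V\rangle$ based on $\mathcal{F}$ adds a valuation $V:\mathbf{P}\to\mathcal{P}(S)$. With $\varphi^{\mathcal{M}}=\{s\in S\mid\mathcal{M},s\vDash\varphi\}$: $\mathcal{M},s\vDash p$ iff $s\in V(p)$; Boolean connectives as usual; $\mathcal{M},s\vDash W\varphi$ iff $\varphi^{\mathcal{M}}\in N(s)$ and $s\notin\varphi^{\mathcal{M}}$. $\mathcal{F}\vDash\varphi$ means $\mathcal{M},s\vDash\varphi$ for all models $\mathcal{M}$ based on $\mathcal{F}$ and all $s\in S$; $\mathcal{F}\vDash\Theta$ means $\mathcal{F}\vDash\varphi$ for all $\varphi\in\Theta$. Frame properties: $\mathcal{F}$ has $(c)$ if for all $s\in S$, $X,Y\in N(s)$ imply $X\cap Y\in N(s)$; $\mathcal{F}$ has $(r)$ if for all $s\in S$, $\bigcap N(s)\in N(s)$. A frame property $P$ is definable in a language $\mathcal{L}$ if there is a set $\Theta\subseteq\mathcal{L}$ such that for every frame $\mathcal{F}$: $\mathcal{F}\vDash\Theta$ iff $\mathcal{F}$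 has $P$; otherwise it is undefinable. *)

(* Defs.v *)
From mathcomp Require Import all_boot boolp classical_sets.

Set Implicit Arguments.
Unset Strict Implicit.
Unset Printing Implicit Defensive.

Local Open Scope classical_set_scope.

Inductive form (P : Type) : Type :=
| Var of P
| Neg of form P
| And of form P & form P
| W of form P.

Record frame : Type := Frame {
  state :> Type;
  state_nonempty : inhabited state;
  nbhd : state -> set (set state)
}.

Record model (P : Type) : Type := Model {
  model_frame :> frame;
  valuation : P -> set model_frame
}.

Fixpoint sat (P : Type) (M : model P) (s : M) (phi : form P) : Prop :=
  match phi with
  | Var p => valuation p s
  | Neg psi => ~ sat s psi
  | And psi chi => sat s psi /\ sat s chi
  | W psi => let psiM := [set t : M | sat t psi] in
             nbhd s psiM /\ ~ psiM s
  end.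

Definition valid (P : Type) (F : frame) (phi : form P) : Prop :=
  forall (V : P -> set F) (s : F), sat (M := Model V) s phi.

Definition valid_set (P : Type) (F : frame) (Theta : set (form P)) : Prop :=
  forall phi : form P, Theta phi -> valid F phi.

Definition definable (P : Type) (prop : frame -> Prop) : Prop :=
  exists Theta : set (form P),
    forall F : frame, valid_set F Theta <-> prop F.

Definition undefinable (P : Type) (prop : frame -> Prop) : Prop :=
  ~ definable P prop.

Definition property_c (F : frame) : Prop :=
  forall (s : F) (X Y : set F), nbhd s X -> nbhd s Y -> nbhd s (X `&` Y).

(* When [nbhd s] is empty, the intersection is the whole carrier [setT]. *)
Definition property_r (F : frame) : Prop :=
  forall s : F, nbhd s (\bigcap_(X in nbhd s) X).

(* Main.v *)
Require Import Defs.
From mathcomp Require Import all_boot boolp classical_sets.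

Set Implicit Arguments.
Unset Strict Implicit.
Unset Printing Implicit Defensive.

Local Open Scope classical_set_scope.

(** Whether [W phi] holds at [s] depends only on the neighborhoods of [s] that
    do not contain [s], so a definable property cannot distinguish the frame
    without neighborhoods from a frame all of whose neighborhoods of [s]
    contain [s].  Among the latter, one violates (c) and one satisfies (r),
    while the frame without neighborhoods satisfies (c) and violates (r). *)

Section NeighborhoodsAvoidingTheState.
Variables (P S : Type) (S_nonempty : inhabited S) (N N' : S -> set (set S)).
Hypothesis eqNN' : forall s X, ~ X s -> N s X <-> N' s X.

Let F := Frame S_nonempty N.
Let F' := Frame S_nonempty N'.

(** In the [W] case, induction gives the argument the same truth set in both models, and that set is
    consulted only if it omits [s], where [N] and [N'] agree. *)
Lemma sat_eq_nbhd (V : P -> set S) (phi : form P) (s : S) :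
  sat (M := @Model P F V) s phi = sat (M := @Model P F' V) s phi.
Proof.
elim: phi s => [p|phi IH|phi IHphi psi IHpsi|phi IH] s //=.
- by rewrite IH.
- by rewrite IHphi IHpsi.
- rewrite (funext IH : [set t | sat (M := @Model P F V) t phi] = _) IH.
  by apply/propext; split=> -[nX Xs]; split=> //; apply/eqNN'.
Qed.

Lemma definable_eq_nbhd (prop : frame -> Prop) :
  definable P prop -> prop F <-> prop F'.
Proof.
move=> [Theta def_prop]; rewrite -!def_prop.
by split=> valF phi /valF valphi V s; move: (valphi V s); rewrite sat_eq_nbhd.
Qed.

End NeighborhoodsAvoidingTheState.

Theorem proposition4p13 (P : Type) (P_nonempty : inhabited P) :
  undefinable P property_c /\ undefinable P property_r.
Proof.
split=> def.
- (* [{None, Some true}] and [{None, Some false}] meet in [{None}]. *)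
  pose N' (s : option bool) := [set X : set (option bool) | X s /\ X <> [set s]].
  have eqN s X : ~ X s -> set0 X <-> N' s X by move=> nXs; split=> // -[].
  have /(_ _) cF' := (definable_eq_nbhd (inhabits None) eqN def).1.
  have pairP b : N' None [set None; Some b].
    split; first by left.
    move=> /(congr1 (@^~ (Some b))) /= E.
    suff : Some b = None by [].
    by rewrite -E; right.
  (* (c) holds vacuously without neighborhoods; once transferred, it forces [[set None]] into
     [N' None], which excludes that singleton. *)
  have [|_] := cF' _ None _ _ (pairP true) (pairP false); first by move=> ? ? ? [].
  by apply; apply/seteqP; split=> [[b|]|_ ->] //=; [case=> -[]// [->] [] | split; left].
- pose N' (s : unit) := [set [set: unit]].
  have eqN s X : ~ X s -> set0 X <-> N' s X.
    by move=> nXs; split=> // XT; apply: nXs; rewrite XT.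
  have rF := (definable_eq_nbhd (inhabits tt) eqN def).2.
  (* The sole neighborhood is its own intersection, so (r) holds for [N']; transferred back, it
     would put a set into the empty family at [tt]. *)
  by apply: rF tt => s; rewrite /N' /= bigcap_set1.
Qed.
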